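(* Let $S \subseteq [0,1]$ be a countable set. Then Bob has a winning strategy in the infinite real number game with target set $S$.
   Context: The infinite real number game with target set $S\subseteq[0,1]$: set $a_0 = 0$ and $b_0 = 1$. Two players, Alice and Bob, alternately choose real numbers, each knowing all previous moves. In round $n \ge 1$, Alice first chooses a real number $a_n$ with $a_{n-1} < a_n < b_{n-1}$, and then Bob chooses a real number $b_n$ with $a_n < b_n < b_{n-1}$. The play continues through all rounds $n = 1, 2, 3, \ldots$. The sequence $(a_n)$ is increasing and bounded above, so $\alpha = \lim_{n\to\infty} a_n$ exists and is a real number between $0$ and $1$. Alice wins if $\alpha \in S$, and Bob wins if $\alpha \notin S$. A strategy for a player is a rule assigning a legal move to each finite history of legal moves at which it is that player's turn. It is a winning strategy if that player wins every infinite play in which all of that player's moves follow the rule, whatever legal moves the opponent makes. A set $X$ is countable if its elements can be listed in a (possibly repeating) infinite sequence $x_1, x_2, x_3, \ldots$; every finite set (including the empty set) is regarded as countable. *)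

(* Defs.v *)
From mathcomp Require Import all_boot all_order all_algebra.
From mathcomp Require Import all_classical all_reals all_analysis.

Set Implicit Arguments.
Unset Strict Implicit.
Unset Printing Implicit Defensive.

Import Order.TTheory GRing.Theory Num.Theory.
Import numFieldNormedType.Exports.

Local Open Scope classical_set_scope.
Local Open Scope ring_scope.

Definition alice_legal {R : realType} (p : R * R) (x : R) : bool :=
  p.1 < x < p.2.

Definition bob_legal {R : realType} (p : R * R) (x y : R) : bool :=
  x < y < p.2.

(* p = (a_{n-1}, b_{n-1}) and q = (a_n, b_n). *)
Definition legal_round {R : realType} : rel (R * R) :=
  fun p q => alice_legal p q.1 && bob_legal p q.1 q.2.

(* (a_0, b_0); histories contain only the moves from round 1 on. *)
Definition game_start {R : realType} : R * R := (0, 1).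

(* At Bob's turn in round n, h = [:: (a_1, b_1); ...; (a_{n-1}, b_{n-1})]
   and x = a_n. *)
Definition legal_bob_history {R : realType} (h : seq (R * R)) (x : R) : bool :=
  path legal_round game_start h && alice_legal (last game_start h) x.

(* A rule is a total function; only its values on legal histories matter. *)
Definition bob_strategy {R : realType} (f : seq (R * R) -> R -> R) : Prop :=
  forall (h : seq (R * R)) (x : R),
    legal_bob_history h x -> bob_legal (last game_start h) x (f h x).

Definition legal_play {R : realType} (a b : nat -> R) : Prop :=
  (a 0%N, b 0%N) = game_start /\
  forall n : nat, legal_round (a n, b n) (a n.+1, b n.+1).

Definition completed_rounds {R : realType} (a b : nat -> R) (n : nat) :
  seq (R * R) := mkseq (fun k => (a k.+1, b k.+1)) n.

Definition bob_follows {R : realType} (f : seq (R * R) -> R -> R)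
  (a b : nat -> R) : Prop :=
  forall n : nat, b n.+1 = f (completed_rounds a b n) (a n.+1).

(* The limit exists for every legal play, by legal_play_cvg. *)
Definition alice_wins {R : realType} (S : set R) (a : nat -> R) : Prop :=
  S (limn a).

Definition bob_wins {R : realType} (S : set R) (a : nat -> R) : Prop :=
  ~ alice_wins S a.

Definition bob_winning_strategy {R : realType} (S : set R)
  (f : seq (R * R) -> R -> R) : Prop :=
  bob_strategy f /\
  forall a b : nat -> R, legal_play a b -> bob_follows f a b -> bob_wins S a.

Lemma legal_play_cvg (R : realType) (a b : nat -> R) :
  legal_play a b -> cvgn a.
Proof.
move=> [[a0 b0] ab].
have aS n : a n < a n.+1 by have /andP[/andP[]] := ab n.
have abn n : a n < b n by case: n => [|n]; [rewrite a0 b0 | have /andP[_ /andP[]] := ab n].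
have b1 n : b n <= 1.
  elim: n => [|n IH]; first by rewrite b0.
  by have /andP[_ /andP[_ /ltW /le_trans]] := ab n; apply.
apply: nondecreasing_is_cvgn; first by apply/nondecreasing_seqP => n; exact: ltW.
by exists 1 => _ [n _ <-]; exact: le_trans (ltW (abn n)) (b1 n).
Qed.

(* Main.v *)
Require Import Defs.
From mathcomp Require Import all_boot all_order all_algebra.
From mathcomp Require Import all_classical all_reals all_analysis.

(** Bob devotes round [n] to the [n]-th element [s] of an enumeration of [S].
    If [s] is a legal move when it is Bob's turn, he plays it. Afterwards the
    sequence [a] stays below a later, strictly smaller [b_k], so its limit is
    less than [s]. If [s] is not legal, then [s] lies outside the open interval
    from [a_n] to [b_(n-1)], while the limit of [a] lies inside it. Either way
    the limit differs from [s], and every element of [S] gets its round. The two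
    lemmas [lt_limn_alice] and [limn_alice_lt] give the strict bounds on the
    limit; [avoidingP] combines them as above. *)

Import Order.TTheory GRing.Theory Num.Theory.
Import numFieldNormedType.Exports.

Local Open Scope classical_set_scope.
Local Open Scope ring_scope.

(** Histories omit the starting interval and list the completed rounds from the
    first on, so [size h] numbers the rounds from 0 and is the index in [e] of
    the point to avoid. *)
Definition avoiding_strategy {R : realType} (e : nat -> R)
    (h : seq (R * R)) (x : R) : R :=
  let s := e (size h) in
  if bob_legal (last game_start h) x s then s
  else (x + (last game_start h).2) / 2.

Lemma avoiding_strategy_legal (R : realType) (e : nat -> R) :
  bob_strategy (avoiding_strategy e).
Proof.
move=> h x /andP[_ /andP[_ xb]]; rewrite /avoiding_strategy.
by case: ifP => // _; rewrite /bob_legal !midf_lt.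
Qed.

Lemma last_completed_rounds (R : realType) (a b : nat -> R) (n : nat) :
  legal_play a b -> last game_start (completed_rounds a b n) = (a n, b n).
Proof.
move=> [ab0 _]; case: n => [|n]; first by rewrite ab0.
by rewrite (last_nth game_start) size_mkseq /= nth_mkseq.
Qed.

Section LimitBounds.
Context (R : realType) (a b : nat -> R) (ab : legal_play a b).

Lemma alice_increasing n : a n < a n.+1.
Proof. by have /andP[/andP[]] := ab.2 n. Qed.

Lemma bob_decreasing n : b n.+1 < b n.
Proof. by have /andP[_ /andP[]] := ab.2 n. Qed.

Lemma alice_lt_bob n : a n < b n.
Proof.
case: n => [|n]; last by have /andP[_ /andP[]] := ab.2 n.
by have [-> ->] := ab.1; exact: ltr01.
Qed.

Lemma alice_nondecreasing : {homo a : m n / (m <= n)%N >-> m <= n}.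
Proof. by apply/nondecreasing_seqP => n; exact/ltW/alice_increasing. Qed.

Lemma lt_limn_alice n : a n < limn a.
Proof.
apply: lt_le_trans (alice_increasing n) _.
apply: nondecreasing_cvgn_le; first exact: alice_nondecreasing.
exact: legal_play_cvg ab.
Qed.

Lemma limn_alice_lt n : limn a < b n.
Proof.
(* Passing to the limit only gives a weak inequality; comparing with the next
   move of Bob makes it strict. *)
apply: le_lt_trans (bob_decreasing n).
apply: limr_le; first exact: legal_play_cvg ab.
exists n.+1 => // m /= nm; apply: le_trans (ltW (alice_lt_bob m)) _.
have /nonincreasing_seqP := fun k => ltW (bob_decreasing k).
exact.
Qed.

End LimitBounds.

Arguments lt_limn_alice {R a b}.
Arguments limn_alice_lt {R a b}.

(** If the limit were [e n], then [e n] would have been a legal move for Bob in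
    the round devoted to it, hence equal to the number [b n.+1] that he played
    there; but the limit is strictly below that number. *)
Lemma avoidingP (R : realType) (e a b : nat -> R) (n : nat) :
  legal_play a b -> bob_follows (avoiding_strategy e) a b -> limn a <> e n.
Proof.
move=> ab fab limE; have bE := fab n.
rewrite /avoiding_strategy last_completed_rounds// size_mkseq in bE.
rewrite /bob_legal -limE (lt_limn_alice ab) (limn_alice_lt ab) /= in bE.
by have := limn_alice_lt ab n.+1; rewrite bE ltxx.
Qed.

(** Values outside [S] are harmless: Bob may as well avoid them. So no case
    distinction is needed for empty or finite [S]. *)
Lemma countable_sub_range (T : pointedType) (S : set T) :
  countable S -> exists e : nat -> T, S `<=` range e.
Proof.
move=> /countable_injP[c c_inj].
exists (fun n => xget point [set s | S s /\ c s = n]) => s Ss.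
exists (c s) => //; case: xgetP => [t _ [St cts]|/(_ s)[]//].
by apply: c_inj; rewrite ?inE.
Qed.

Theorem proposition1 (R : realType) (S : set R)
  (S01 : S `<=` `[0, 1]) (cS : countable S) :
  exists f : seq (R * R) -> R -> R, bob_winning_strategy S f.
Proof.
have [e Se] := countable_sub_range _ _ cS.
exists (avoiding_strategy e); split; first exact: avoiding_strategy_legal.
move=> a b ab fab /Se[n _ /esym]; exact: avoidingP ab fab.
Qed.
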